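(* There is an $\mathsf{RNC}$ algorithm with depth $O(\log n)$ and work $O(m)$ for allocation instances with $m$ goods and $n$ agents with additive valuations that outputs an $\mathsf{EF}(\tilde O(\sqrt{m/n}))$ allocation with high probability.
   Context: An allocation instance has a set $M$ of $m$ goods, $n$ agents, and additive valuations $v_i:2^M\to\mathbb{R}_{\ge0}$, $v_i(S)=\sum_{g\in S}v_i(g)$. An allocation $\mathcal{A}$ is envy-free up to $k$ goods, $\mathsf{EF}(k)$, if for every pair of agents $i,j$ there is a set $S\subseteq\mathcal{A}(j)$ of at most $k$ goods with $v_i(\mathcal{A}(i))\ge v_i(\mathcal{A}(j)\setminus S)$. $\mathsf{RNC}$: randomized parallel algorithm (binary fork-join work-depth model) with polylogarithmic depth and polynomial work that is correct with high probability (probability at least $1-1/n^c$ for any constant $c$).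
   Formalization: Depth is proved as O(log(n+m)) in general and O(log n) when n ≥ 2 and m is polynomially bounded in n (binary forks force depth Ω(log m)), and the fairness bound is Õ(max(1, √(m/n))), since fewer than one removed good is impossible when m is much smaller than n. *)

(* Defs.v *)
From HB Require Import structures.
From mathcomp Require Import all_boot all_order all_algebra.
From mathcomp Require Import boolp reals exp.

Set Implicit Arguments.
Unset Strict Implicit.
Unset Printing Implicit Defensive.

Import Order.TTheory GRing.Theory Num.Theory.
Local Open Scope ring_scope.

(** * Fair division *)

(* An additive valuation profile is given by the values of single goods. *)
Definition valuations (R : realType) (n m : nat) := 'I_n -> 'I_m -> R.

Definition nonneg_valuations (R : realType) n m (v : valuations R n m) : Prop :=
  forall i g, 0 <= v i g.

Definition bundle_value (R : realType) n m (v : valuations R n m)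
    (i : 'I_n) (S : {set 'I_m}) : R := \sum_(g in S) v i g.

(* A partition of the goods among the agents, encoded by the owner map. *)
Definition allocation (n m : nat) := {ffun 'I_m -> 'I_n}.

Definition bundle n m (A : allocation n m) (j : 'I_n) : {set 'I_m} :=
  [set g | A g == j].

Definition EF (R : realType) (k : nat) n m (v : valuations R n m)
    (A : allocation n m) : Prop :=
  forall i j : 'I_n, exists S : {set 'I_m},
    [/\ S \subset bundle A j, (#|S| <= k)%N &
        bundle_value v i (bundle A j :\: S) <= bundle_value v i (bundle A i)].

(** * Finite random experiments *)

(* [Draw k f] draws i uniformly from {0, .., k-1}, independently of all
   earlier draws, and continues as [f i]. *)
Inductive rtree (A : Type) : Type :=
| Leaf of A
| Draw of nat & (nat -> rtree A).
Arguments Leaf {A}.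
Arguments Draw {A}.

Fixpoint rbind A B (t : rtree A) (h : A -> rtree B) : rtree B :=
  match t with
  | Leaf a => h a
  | Draw k f => Draw k (fun i => rbind (f i) h)
  end.

Fixpoint prob (R : realType) A (E : A -> Prop) (t : rtree A) : R :=
  match t with
  | Leaf a => (`[< E a >])%:R
  | Draw k f => (\sum_(i < k) prob R E (f i)) / k%:R
  end.

Fixpoint surely A (E : A -> Prop) (t : rtree A) : Prop :=
  match t with
  | Leaf a => E a
  | Draw k f => forall i, (i < k)%N -> surely E (f i)
  end.

(** * The binary fork-join work-depth model *)

(* A RAM with a binary fork.  Each thread has registers of its own; memory is
   shared.  Words are natural numbers or, since valuations are real, reals.
   Arithmetic is limited to addition, subtraction, halving and comparison, so
   that integers along a path of length d exceed those at its start and the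
   constants of the program by a factor of at most 2^d, and unit cost is
   legitimate. *)
Inductive arith_op := Add | Sub | Half | Le.

Inductive instr :=
| Const (r k : nat)              (* r := k *)
| Arith (o : arith_op) (r a b : nat)  (* r := a o b; Half ignores b *)
| Read (r a : nat)               (* r := mem[a] *)
| Write (a b : nat)              (* mem[a] := b *)
| Value (r i g : nat)            (* r := v_i(g), read from the input *)
| Rand (r a : nat).              (* r := uniform in {0, .., a-1} *)

Inductive cmd :=
| Skip
| Do of instr
| Seq of cmd & cmd
| If of nat & cmd & cmd          (* tests whether the register is nonzero *)
| Par of cmd & cmd
| Call of nat.

(* A finite list of mutually recursive procedures; execution starts at the
   first one.  The program is fixed independently of n, m and v. *)
Definition program := seq cmd.

Inductive word (R : realType) := Int of nat | Real of R.
Arguments Int {R}.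

Definition as_real (R : realType) (x : word R) : R :=
  match x with Int a => a%:R | Real a => a end.

Definition as_nat (R : realType) (x : word R) : nat :=
  if x is Int a then a else 0%N.

Definition arith (R : realType) (o : arith_op) (x y : word R) : word R :=
  match o, x, y with
  | Add, Int a, Int b => Int (a + b)%N
  | Add, _, _ => Real (as_real x + as_real y)
  | Sub, Int a, Int b => Int (a - b)%N
  | Sub, _, _ => Real (as_real x - as_real y)
  | Half, Int a, _ => Int a./2
  | Half, Real a, _ => Real (a / 2)
  | Le, _, _ => Int (as_real x <= as_real y)%R
  end.

(* [rd] and [wr] log the memory addresses read and written, for the detection
   of races; [wk] and [dp] are the work and the depth spent. *)
Record state (R : realType) := State {
  regs : nat -> word R;
  mem : nat -> word R;
  rd : seq nat;
  wr : seq nat;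
  wk : nat;
  dp : nat
}.

Definition upd T (f : nat -> T) (a : nat) (x : T) : nat -> T :=
  fun b => if b == a then x else f b.

Definition tick (R : realType) (s : state R) : state R :=
  State (regs s) (mem s) (rd s) (wr s) (wk s).+1 (dp s).+1.

Definition set_reg (R : realType) (s : state R) (r : nat) (x : word R) :=
  State (upd (regs s) r x) (mem s) (rd s) (wr s) (wk s) (dp s).

Definition input_value (R : realType) n m (v : valuations R n m)
    (i g : nat) : R :=
  match insub i, insub g with
  | Some i', Some g' => v i' g'
  | _, _ => 0
  end.

(* [None] is a failed run. *)
Definition step (R : realType) n m (v : valuations R n m) (x : instr)
    (s0 : state R) : rtree (option (state R)) :=
  let s := tick s0 in
  let reg := regs s in
  match x with
  | Const r k => Leaf (Some (set_reg s r (Int k)))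
  | Arith o r a b => Leaf (Some (set_reg s r (arith o (reg a) (reg b))))
  | Read r a =>
      let p := as_nat (reg a) in
      Leaf (Some (State (upd reg r (mem s p)) (mem s)
                        (p :: rd s) (wr s) (wk s) (dp s)))
  | Write a b =>
      let p := as_nat (reg a) in
      Leaf (Some (State reg (upd (mem s) p (reg b))
                        (rd s) (p :: wr s) (wk s) (dp s)))
  | Value r i g =>
      Leaf (Some (set_reg s r
        (Real (input_value v (as_nat (reg i)) (as_nat (reg g))))))
  | Rand r a =>
      let k := as_nat (reg a) in
      if k == 0%N then Leaf None
      else Draw k (fun i => Leaf (Some (set_reg s r (Int i))))
  end.

Definition fork (R : realType) (s : state R) : state R :=
  State (regs s) (mem s) [::] [::] 0 0.

Definition race (R : realType) (s1 s2 : state R) : bool :=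
  [|| has (mem_seq (wr s1)) (wr s2), has (mem_seq (wr s1)) (rd s2)
    | has (mem_seq (wr s2)) (rd s1)].

(* The join of the branches s1 and s2 forked at s: the registers of the parent
   are unchanged, works add up, and depths are combined by maximum. *)
Definition join (R : realType) (s s1 s2 : state R) : state R :=
  State (regs s)
        (fun a => if a \in wr s1 then mem s1 a else mem s2 a)
        (rd s ++ rd s1 ++ rd s2) (wr s ++ wr s1 ++ wr s2)
        (wk s + wk s1 + wk s2)%N (dp s + maxn (dp s1) (dp s2))%N.

(* Both branches of a fork start from the memory at the fork.  A race is an
   error, so the outcome of a successful run does not depend on the
   interleaving of the branches. *)
Fixpoint exec (R : realType) n m (v : valuations R n m) (P : program)
    (fuel : nat) (c : cmd) (s : state R) : rtree (option (state R)) :=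
  if fuel is fuel'.+1 then
    match c with
    | Skip => Leaf (Some s)
    | Do x => step v x s
    | Seq c1 c2 =>
        rbind (exec v P fuel' c1 s) (fun o =>
          if o is Some s' then exec v P fuel' c2 s' else Leaf None)
    | If r c1 c2 =>
        exec v P fuel' (if as_real (regs s r) == 0 then c2 else c1) (tick s)
    | Par c1 c2 =>
        rbind (exec v P fuel' c1 (fork s)) (fun o1 =>
        rbind (exec v P fuel' c2 (fork s)) (fun o2 =>
          match o1, o2 with
          | Some s1, Some s2 =>
              Leaf (if race s1 s2 then None else Some (join (tick s) s1 s2))
          | _, _ => Leaf None
          end))
    | Call p => exec v P fuel' (nth Skip P p) (tick s)
    end
  else Leaf None.

(* Register 0 holds n and register 1 holds m; all else is 0. *)
Definition init (R : realType) (n m : nat) : state R :=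
  State (fun r => Int (nth 0%N [:: n; m] r)) (fun=> Int 0) [::] [::] 0 0.

Definition run (R : realType) n m (v : valuations R n m) (P : program)
    (fuel : nat) : rtree (option (state R)) :=
  exec v P fuel (nth Skip P 0) (init R n m).

Definition terminates_within (R : realType) n m (v : valuations R n m)
    (P : program) (w d : nat) : Prop :=
  exists fuel, surely
    (fun o => if o is Some s then (wk s <= w)%N /\ (dp s <= d)%N else False)
    (run v P fuel).

(* The output is the array of owners at addresses 0, .., m-1. *)
Definition outputs (R : realType) n m (Q : allocation n m -> Prop)
    (o : option (state R)) : Prop :=
  if o is Some s then
    exists A : allocation n m, (forall g : 'I_m, mem s g = Int (A g)) /\ Q A
  else False.

(** * Asymptotics in the number n of agents and the number m of goods *)

Definition bigO_on (R : realType) (D : nat -> nat -> Prop)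
    (f : nat -> nat -> nat) (g : nat -> nat -> R) : Prop :=
  exists C : R, forall n m, (0 < n)%N -> (0 < m)%N -> D n m ->
    (f n m)%:R <= C * g n m.

Definition bigO (R : realType) (f : nat -> nat -> nat) (g : nat -> nat -> R) :=
  bigO_on (fun _ _ => True) f g.

(* For n, m >= 1, the quantities n + m and n * m (the input size) are
   polynomially related; n + m >= 2 keeps the logarithm positive. *)
Definition Otilde (R : realType) (f : nat -> nat -> nat)
    (g : nat -> nat -> R) : Prop :=
  exists a : nat, bigO f (fun n m => ln ((n + m)%:R : R) ^+ a * g n m).

Definition polylog (R : realType) (f : nat -> nat -> nat) : Prop :=
  Otilde f (fun _ _ => 1 : R).

Definition polynomial_bound (R : realType) (f : nat -> nat -> nat) : Prop :=
  exists a : nat, bigO f (fun n m => (n + m)%:R ^+ a : R).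

(** * RNC algorithms for allocation problems *)

(* Worst case over all instances and all random choices. *)
Definition has_cost (R : realType) (P : program)
    (work depth : nat -> nat -> nat) : Prop :=
  forall n m (v : valuations R n m), (0 < n)%N -> nonneg_valuations v ->
    terminates_within v P (work n m) (depth n m).

Definition alloc_problem (R : realType) :=
  forall n m, valuations R n m -> allocation n m -> Prop.

Definition correct_whp (R : realType) (P : program) (c : R)
    (Q : alloc_problem R) : Prop :=
  forall n m (v : valuations R n m), (0 < n)%N -> nonneg_valuations v ->
    exists fuel,
      1 - (n%:R `^ c)^-1 <= prob R (outputs (Q n m v)) (run v P fuel).

(* The required property may depend on the exponent c of the success
   probability, through the constants in its asymptotic bounds. *)
Definition RNC (R : realType) (P : program) (Q : R -> alloc_problem R) : Prop :=
  (exists work depth, [/\ has_cost R P work depth,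
                          polynomial_bound R work & polylog R depth]) /\
  (forall c : R, correct_whp P c (Q c)).

(* Main.v *)
(** Give every good to an independent uniformly random agent; a range of goods
    is handled by assigning its first good and forking on the two halves of the
    rest, which costs linear work and logarithmic depth.

    Fix agents i, j and sort the goods by v_i.  If, for every upper level set T
    of v_i, the bundle of j contains at most k more goods of T than the bundle
    of i, then a greedy matching shows that i stops envying j once the k most
    valuable goods of j are removed.  For a fixed T the difference of the two
    counts is a sum of |T| independent variables with values in {-1, 0, 1}, mean
    0 and variance at most 2/n.  Its exponential moment at
    lam = 1 / (2 max(1, sqrt(m/n))) is at most e, so the difference exceeds k
    with probability at most exp(1 - lam (k + 1)).  A union bound over the n^2 m
    triples (i, j, T) leaves k = O(log(n + m) max(1, sqrt(m/n))). *)

Require Import Defs.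
From HB Require Import structures.
From mathcomp Require Import all_boot all_order all_algebra.
From mathcomp Require Import boolp reals sequences exp.
From mathcomp Require Import ring lra zify.

Import Order.TTheory GRing.Theory Num.Theory.
Local Open Scope ring_scope.

(** * Removing goods to eliminate envy *)

Lemma exists_minimizer (R : realDomainType) (T : finType) (f : T -> R)
    (X : {set T}) :
  (0 < #|X|)%N -> exists2 g, g \in X & forall h, h \in X -> f g <= f h.
Proof.
by case/card_gt0P=> x0 x0X; have [g gX g_min] := arg_minP f x0X; exists g.
Qed.

(** Induction on the size of [X]. At most [k] remaining elements are all removed; otherwise the
    hypothesis at a cheapest element of [X] provides a partner in [Y] of at least its value. *)
Lemma dominated_after_removal (R : realDomainType) (T : finType) (f : T -> R)
    (k : nat) (X Y : {set T}) :
  (forall g, 0 <= f g) ->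
  (forall g, g \in X ->
     (#|[set h in X | (f g <= f h)%R]| <=
      #|[set h in Y | (f g <= f h)%R]| + k)%N) ->
  exists S : {set T},
    [/\ S \subset X, (#|S| <= k)%N &
        \sum_(g in X :\: S) f g <= \sum_(g in Y) f g].
Proof.
move=> f_ge0; move: {2}#|X| (erefl #|X|) => p.
elim: p X Y => [|p IHp] X Y cardX hXY.
  exists set0; split; rewrite ?sub0set ?cards0 //.
  by rewrite (cards0_eq cardX) set0D big_set0 sumr_ge0.
have [le_Xk|lt_kX] := leqP #|X| k.
  by exists X; split=> //; rewrite setDv big_set0 sumr_ge0.
(* Matching a cheapest good g of X with a cheapest good y of Y among those
   worth at least g preserves the hypothesis. *)
have [|g gX g_min] := exists_minimizer R T f X; first by rewrite cardX.
have Xg : [set h in X | (f g <= f h)%R] = X.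
  by apply/setP=> h; rewrite inE; case hX: (h \in X) => //=; exact: g_min.
have leXY := hXY g gX; rewrite Xg in leXY.
have [|y] := exists_minimizer R T f [set h in Y | f g <= f h]; first by lia.
rewrite inE => /andP[yY le_gy] y_min.
have cardXg : #|X :\ g| = p by move: (cardsD1 g X); rewrite gX cardX => -[].
have [|h|S [subS leSk leS]] := IHp (X :\ g) (Y :\ y) => //.
  rewrite !inE => /andP[_ hX].
  have sub1 : [set x in X :\ g | (f h <= f x)%R] =
      [set x in X | (f h <= f x)%R] :\ g.
    by apply/setP=> x; rewrite !inE andbA.
  have sub2 : [set x in Y :\ y | (f h <= f x)%R] =
      [set x in Y | (f h <= f x)%R] :\ y.
    by apply/setP=> x; rewrite !inE andbA.
  rewrite sub1 sub2.
  have := cardsD1 y [set x in Y | (f h <= f x)%R]; rewrite !inE yY /=.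
  (* If [y] is worth less than [h], the level set of [Y] at [h] does not lose [y], and the
     hypothesis at [h] suffices. Otherwise it contains the level set at [g], since [y] is cheapest
     there, and the hypothesis at [g] suffices. *)
  have [le_hy|lt_yh] := leP (f h) (f y) => cardYh; last first.
    by have := hXY h hX; have := cardsD1 g [set x in X | (f h <= f x)%R]; lia.
  have : (#|[set x in Y | (f g <= f x)%R]| <=
          #|[set x in Y | (f h <= f x)%R]|)%N.
    apply/subset_leq_card/subsetP => x xYg; move: (y_min x xYg) (xYg).
    by rewrite !inE => le_yx /andP[-> _]; rewrite (le_trans le_hy).
  have : (#|[set x in X | (f h <= f x)%R] :\ g| <= #|X :\ g|)%N.
    by apply/subset_leq_card/setSD/subsetP => x; rewrite inE => /andP[].
  lia.
exists S; split=> //; first exact: subset_trans subS (subsetDl _ _).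
(* So [g] survives the removal, and its value is paid for by that of [y]. *)
have gS : g \notin S.
  by apply/negP => /(subsetP subS); rewrite !inE eqxx.
rewrite (big_setD1 g) ?inE ?gX ?gS //=.
rewrite [leRHS](big_setD1 y) //= lerD //.
by move: leS; rewrite !setDDl setUC.
Qed.

(** * Expectations and couplings of finite experiments *)

Section Experiments.
Context {R : realType}.
Implicit Types A B : Type.

Fixpoint expect A (f : A -> R) (t : rtree A) : R :=
  match t with
  | Leaf a => f a
  | Draw k g => (\sum_(i < k) expect A f (g i)) / k%:R
  end.
Arguments expect {A}.

Lemma expect_bind A B (f : B -> R) (t : rtree A) (h : A -> rtree B) :
  expect f (rbind t h) = expect (fun a => expect f (h a)) t.
Proof. by elim: t => //= k g IH; under eq_bigr do rewrite IH. Qed.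

Lemma eq_expect A (f g : A -> R) (t : rtree A) :
  f =1 g -> expect f t = expect g t.
Proof. by move=> fg; elim: t => //= k h IH; under eq_bigr do rewrite IH. Qed.

Lemma expectZ A (c : R) (f : A -> R) (t : rtree A) :
  expect (fun a => c * f a) t = c * expect f t.
Proof.
elim: t => //= k h IH.
by under eq_bigr do rewrite IH; rewrite -mulr_sumr mulrA.
Qed.

Lemma expect_sum A (I : finType) (f : I -> A -> R) (t : rtree A) :
  expect (fun a => \sum_i f i a) t = \sum_i expect (f i) t.
Proof.
elim: t => //= k h IH.
by under eq_bigr do rewrite IH; rewrite exchange_big /= mulr_suml.
Qed.

Lemma expectB A (f g : A -> R) (t : rtree A) :
  expect (fun a => f a - g a) t = expect f t - expect g t.
Proof.
elim: t => //= k h IH.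
by under eq_bigr do rewrite IH; rewrite sumrB mulrBl.
Qed.

(** Relates a run of the program to an ideal experiment with the same draws, so that bounds proved
    for the latter transfer to the former. *)
Fixpoint coupled A B (rel : A -> B -> Prop) (t : rtree A) (u : rtree B)
    : Prop :=
  match t, u with
  | Leaf a, Leaf b => rel a b
  | Draw k f, Draw l g =>
      k = l /\ forall i, (i < k)%N -> coupled A B rel (f i) (g i)
  | _, _ => False
  end.
Arguments coupled {A B}.

Lemma coupled_bind A B A' B' (rel : A -> B -> Prop) (rel' : A' -> B' -> Prop)
    (t : rtree A) (u : rtree B) (h : A -> rtree A') (h' : B -> rtree B') :
  coupled rel t u -> (forall a b, rel a b -> coupled rel' (h a) (h' b)) ->
  coupled rel' (rbind t h) (rbind u h').
Proof.
move=> + hh'; elim: t u => [a|k f IH] [b|l g] //= => [/hh' //|[-> fg]].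
by split=> // i /fg; exact: IH.
Qed.

Lemma coupled_surely A B (rel : A -> B -> Prop) (E : A -> Prop)
    (t : rtree A) (u : rtree B) :
  coupled rel t u -> (forall a b, rel a b -> E a) -> surely E t.
Proof.
move=> + relE; elim: t u => [a|k f IH] [b|l g] //= => [/relE //|[_ fg]].
by move=> i /fg; exact: IH.
Qed.

Lemma coupled_prob A B (rel : A -> B -> Prop) (E : A -> Prop) (f : B -> R)
    (t : rtree A) (u : rtree B) :
  coupled rel t u -> (forall a b, rel a b -> f b <= (`[< E a >])%:R) ->
  expect f u <= prob R E t.
Proof.
move=> + relE; elim: t u => [a|k h IH] [b|l g] //= => [/relE //|[<- fg]].
rewrite ler_wpM2r ?invr_ge0 //; apply: ler_sum => i _.
by apply: IH; exact: fg.
Qed.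

Fixpoint draws (n m : nat) : rtree (seq nat) :=
  if m is m'.+1 then
    Draw n (fun i => rbind (draws n m') (fun w => Leaf (i :: w)))
  else Leaf [::].

Lemma rbindA A B C (t : rtree A) (f : A -> rtree B) (g : B -> rtree C) :
  rbind (rbind t f) g = rbind t (fun a => rbind (f a) g).
Proof. by elim: t => //= k h IH; congr Draw; apply/funext. Qed.

(** Matches the fork: the left branch consumes the first block of draws, the right branch the
    second. *)
Lemma drawsD (n a b : nat) :
  draws n (a + b) = rbind (draws n a) (fun w1 =>
    rbind (draws n b) (fun w2 => Leaf (w1 ++ w2))).
Proof.
elim: a => [|a IH] /=.
  elim: (draws n b) => //= k h IH; congr Draw; exact/funext.
congr Draw; apply/funext => i; rewrite IH !rbindA; congr rbind.
by apply/funext => w1; rewrite !rbindA.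
Qed.

Lemma expect_const_draws (n m : nat) (c : R) :
  (0 < n)%N -> expect (fun=> c) (draws n m) = c.
Proof.
move=> n_gt0; elim: m => //= m IH.
under eq_bigr do rewrite expect_bind /= IH.
by rewrite sumr_const card_ord -[c *+ n]mulr_natr mulfK // pnatr_eq0 -lt0n.
Qed.

(** This is independence of the draws; the first one is split off at each step. *)
Lemma expect_draws_prod (n m : nat) (F : 'I_m -> nat -> R) :
  expect (fun w => \prod_(g < m) F g (nth 0%N w g)) (draws n m) =
  \prod_(g < m) ((\sum_(i < n) F g i) / n%:R).
Proof.
elim: m F => [|m IH] F /=; first by rewrite !big_ord0.
rewrite big_ord_recl -(IH (fun g => F (lift ord0 g))) mulrAC.
rewrite [in RHS]mulr_suml; congr (_ / _).
apply: eq_bigr => i _; rewrite expect_bind /= -expectZ.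
by apply: eq_expect => w; rewrite big_ord_recl.
Qed.
End Experiments.
Arguments expect {R A}.
Arguments coupled {A B}.

(** * Exponential moments and the union bound *)

Lemma expR_le_quadratic (R : realType) (x : R) :
  x <= 2^-1 -> expR x <= 1 + x + 2 * x ^+ 2.
Proof.
move=> x_le; have x1_gt0 : 0 < 1 - x by lra.
apply: (@le_trans _ _ (1 - x)^-1).
  rewrite -[expR x]invrK lef_pV2 ?posrE ?invr_gt0 ?expR_gt0 //.
  by rewrite -expRN expR_ge1Dx.
have := mulfV (lt0r_neq0 x1_gt0); have : 0 < (1 - x)^-1 by rewrite invr_gt0.
(* Inverting [1 - x <= exp (- x)] bounds [exp x] by [u]. Expanding [u = 1 + u * x] twice gives
   [1 + x + u * x ^+ 2]. *)
set u := (1 - x)^-1 => u_gt0 xu.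
have u_le2 : u <= 2.
  rewrite -[leRHS]invrK lef_pV2 ?posrE ?invr_gt0 //; lra.
have e : u = 1 + u * x by lra.
have -> : u = 1 + x + u * x ^+ 2 by rewrite {1}e {1}e; ring.
by rewrite lerD2l ler_wpM2r ?sqr_ge0.
Qed.

Section Concentration.
Context {R : realType} {n m : nat}.
Implicit Types (w : seq nat) (v : valuations R n m).
Implicit Types (T : {set 'I_m}) (i j : 'I_n).

(** The default [i0] is taken only for entries that are not agents. *)
Definition owner_map (i0 : 'I_n) (w : seq nat) : allocation n m :=
  [ffun g : 'I_m => insubd i0 (nth 0%N w g)].

Definition top_goods v i (g : 'I_m) : {set 'I_m} := [set h | v i g <= v i h].

(** Written as a product over all goods, so that its expectation factorizes; [moment_card] gives the
    form in terms of bundle sizes. *)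
Definition moment (lam : R) i j T (w : seq nat) : R :=
  \prod_(g < m) (if g \in T then
    expR (lam * ((nth 0%N w g == j)%:R - (nth 0%N w g == i)%:R)) else 1).

Lemma nat_owner_map i0 w (g : 'I_m) :
  size w = m -> all (fun a => a < n)%N w ->
  owner_map i0 w g = nth 0%N w g :> nat.
Proof.
move=> sz_w w_lt; rewrite ffunE val_insubd.
by rewrite (all_nthP 0%N w_lt) ?sz_w.
Qed.

Lemma moment_card lam i0 i j T w :
  size w = m -> all (fun a => a < n)%N w ->
  moment lam i j T w =
  expR (lam * (#|bundle (owner_map i0 w) j :&: T|%:R
             - #|bundle (owner_map i0 w) i :&: T|%:R)).
Proof.
move=> sz_w w_lt.
have card_bundle l : #|bundle (owner_map i0 w) l :&: T|%:R =
    \sum_(g in T) (nth 0%N w g == l)%:R :> R.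
  rewrite -sum1_card natr_sum big_mkcond [RHS]big_mkcond /=.
  apply: eq_bigr => g _; rewrite !inE -val_eqE /= nat_owner_map //.
  by case: (g \in T); case: eqP.
by rewrite !card_bundle -sumrB mulr_sumr expR_sum /moment -big_mkcond.
Qed.

Lemma not_EF_moment (lam : R) (k : nat) i0 v w :
  0 <= lam -> nonneg_valuations v ->
  size w = m -> all (fun a => a < n)%N w -> ~ EF k v (owner_map i0 w) ->
  exists i j g, expR (lam * k.+1%:R) <= moment lam i j (top_goods v i g) w.
Proof.
move=> lam_ge0 v_ge0 sz_w w_lt notEF; apply: contrapT => no_large.
apply: notEF => i j.
apply: (dominated_after_removal _ _ (v i)) => [g|g gj]; first exact: v_ge0.
rewrite leqNgt; apply/negP => gap; apply: no_large; exists i, j, g.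
rewrite (moment_card _ i0) // ler_expR ler_wpM2l //.
rewrite lerBrDr -natrD ler_nat.
have topE l : bundle (owner_map i0 w) l :&: top_goods v i g =
    [set h in bundle (owner_map i0 w) l | v i g <= v i h].
  by apply/setP => h; rewrite !inE.
by rewrite !topE addSn addnC.
Qed.

(** Markov's inequality and the union bound, pointwise: if the allocation fails, some summand is at
    least 1; if not, the sum is still nonnegative. *)
Lemma EF_indicator_ge (lam : R) (k : nat) i0 v w :
  0 <= lam -> nonneg_valuations v ->
  size w = m -> all (fun a => a < n)%N w ->
  1 - \sum_i \sum_j \sum_g
        expR (- (lam * k.+1%:R)) * moment lam i j (top_goods v i g) w
  <= (`[< EF k v (owner_map i0 w) >])%:R.
Proof.
move=> lam_ge0 v_ge0 sz_w w_lt.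
have term_ge0 i j g :
    0 <= expR (- (lam * k.+1%:R)) * moment lam i j (top_goods v i g) w.
  by rewrite mulr_ge0 ?expR_ge0 // (moment_card _ i0) // expR_ge0.
have [EFk|] := asboolP (EF k v _); first rewrite gerBl.
  by apply: sumr_ge0 => i _; apply: sumr_ge0 => j _; exact: sumr_ge0.
case/(not_EF_moment _ _ _ _ _ lam_ge0 v_ge0 sz_w w_lt) => i [j [g large]].
rewrite subr_le0.
have le_term (I : finType) (F : I -> R) x :
    (forall y, 0 <= F y) -> F x <= \sum_y F y.
  by move=> F_ge0; rewrite (bigD1 x) //= lerDl sumr_ge0.
have sum_ge0 i' j' : 0 <= \sum_g
    expR (- (lam * k.+1%:R)) * moment lam i' j' (top_goods v i' g) w.
  exact: sumr_ge0.
apply: le_trans (le_term _ _ i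
  (fun i' => sumr_ge0 _ (fun j' _ => sum_ge0 i' j'))).
apply: le_trans (le_term _ _ j (sum_ge0 i)).
apply: le_trans (le_term _ _ g (term_ge0 i j)).
by rewrite expRN mulrC ler_pdivlMr ?mul1r ?expR_gt0.
Qed.

(** Each of the [m] factors has mean at most [1 + 1/m <= exp (1/m)]: the bound on [4 * lam ^+ 2 * m]
    controls the second-order term [4 * lam ^+ 2 / n]. *)
Lemma expect_moment_le (lam : R) i j T :
  (0 < m)%N -> 0 <= lam <= 2^-1 -> 4 * lam ^+ 2 * m%:R <= n%:R ->
  expect (moment lam i j T) (draws n m) <= expR 1.
Proof.
move=> m_gt0 /andP[lam_ge0 lam_le] lam_m.
have n_gt0 : (0 < n)%N by apply: leq_ltn_trans (ltn_ord i).
have [nR mR] : 0 < n%:R :> R /\ 0 < m%:R :> R by rewrite !ltr0n; split.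
have -> : expect (moment lam i j T) (draws n m) = _ :=
  expect_draws_prod _ _ (fun g a => if g \in T then
    expR (lam * ((a == j)%:R - (a == i)%:R)) else 1).
apply: (@le_trans _ _ (\prod_(g < m) expR (m%:R^-1 : R))); last first.
  by rewrite prodr_const card_ord -expRM_natl mulfV ?gt_eqF.
apply: ler_prod => g _; apply/andP; split.
  by rewrite divr_ge0 // sumr_ge0 // => a _; case: ifP; rewrite ?expR_ge0.
case: (g \in T); last first.
  rewrite sumr_const card_ord divff ?gt_eqF //.
  by rewrite -[leLHS]expR0 ler_expR invr_ge0 ltW.
apply: le_trans (expR_ge1Dx _); rewrite ler_pdivrMr //.
have sum_delta (l : 'I_n) : \sum_(a < n) (a == l :> nat)%:R = 1 :> R.
  rewrite (bigD1 l) //= eqxx big1 ?addr0 // => a /negPf.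
  by rewrite -val_eqE /= => ->.
(* The linear terms cancel in the sum, and the squared difference of the two indicators is at most
   their sum. *)
apply: (@le_trans _ _ (\sum_(a < n)
    (1 + lam * ((a == j :> nat)%:R - (a == i :> nat)%:R)
     + 2 * lam ^+ 2 * ((a == j :> nat)%:R + (a == i :> nat)%:R)))).
  apply: ler_sum => a _; apply: le_trans (expR_le_quadratic _ _ _) _.
    by case: eqP; case: eqP => _ _; rewrite /=; lra.
  rewrite -!addrA lerD2l lerD2l exprMn mulrA ler_wpM2l ?mulr_ge0 ?sqr_ge0 //.
  by case: eqP; case: eqP => _ _; rewrite /=; lra.
rewrite !big_split /= -!mulr_sumr sumrB big_split /= !sum_delta.
rewrite sumr_const card_ord.
rewrite subrr mulr0 addr0 [leRHS]mulrDl mul1r lerD2l.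
rewrite -(ler_pM2r mR) [leRHS]mulrAC mulVf ?gt_eqF // mul1r; lra.
Qed.

Lemma EF_expectation_ge (lam : R) (k : nat) v :
  (0 < m)%N -> (0 < n)%N -> 0 <= lam <= 2^-1 -> 4 * lam ^+ 2 * m%:R <= n%:R ->
  1 - (n%:R ^+ 2 * m%:R) * expR (1 - lam * k.+1%:R) <=
  expect (fun w => 1 - \sum_i \sum_j \sum_g
        expR (- (lam * k.+1%:R)) * moment lam i j (top_goods v i g) w)
    (draws n m).
Proof.
move=> m_gt0 n_gt0 lam_itv lam_m.
rewrite expectB expect_const_draws // lerD2l lerN2 expect_sum.
apply: (@le_trans _ _ (\sum_(i < n) \sum_(j < n) \sum_(g < m)
  expR (1 - lam * k.+1%:R))).
  apply: ler_sum => i _; rewrite expect_sum; apply: ler_sum => j _.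
  rewrite expect_sum; apply: ler_sum => g _; rewrite expectZ expRD mulrC.
  by rewrite ler_wpM2r ?expR_ge0 ?expect_moment_le.
rewrite !sumr_const !card_ord -!mulrnA -[leLHS]mulr_natl !natrM.
by rewrite le_eqVlt; apply/orP; left; apply/eqP; ring.
Qed.
End Concentration.

(** * The parallel program and its execution *)

(* Calling convention: register 0 holds the number of agents, register 1 the
   length of the range of goods to assign, register 2 its first good. *)
Definition assign_left : cmd := Seq (Do (Arith Half 1 1 1)) (Call 0).

Definition assign_right : cmd :=
  Seq (Do (Arith Defs.Sub 1 1 4)) (Seq (Do (Arith Add 2 2 4)) (Call 0)).

(** Register 3 holds the drawn owner and is then reused for the constant 1; register 4 keeps the
    length of the left half for the right branch. *)
Definition assign_first_then (c : cmd) : cmd :=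
  Seq (Do (Write 2 3)) (Seq (Do (Const 3 1))
    (Seq (Do (Arith Defs.Sub 1 1 3)) (Seq (Do (Arith Add 2 2 3))
    (Seq (Do (Arith Half 4 1 1)) c)))).

Definition assign_range : cmd :=
  If 1
    (Seq (Do (Rand 3 0)) (assign_first_then (Par assign_left assign_right)))
    Skip.

Definition assign : program := [:: assign_range].

Section Execution.
Context {R : realType} {n m : nat} (v : valuations R n m).

(** The exact logs serve to exclude races. As for work, each good costs 8 steps up to and including
    the fork and 5 to enter the two calls; the [len + 1] calls on empty ranges cost 1 each. *)
Definition assigned (lo len d : nat) (s : state R) (o : option (state R))
    (w : seq nat) : Prop :=
  exists s', [/\ o = Some s',
    size w = len /\ all (fun a => a < n)%N w,
    forall a, Defs.mem s' a =
      if (lo <= a < lo + len)%N then Int (nth 0%N w (a - lo)) else Defs.mem s a,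
    rd s' = rd s /\
      (forall a, (a \in wr s') = (a \in wr s) || (lo <= a < lo + len)%N) &
    wk s' = (wk s + 14 * len + 1)%N /\ (dp s' <= dp s + d)%N].

Lemma exec_Seq (P : program) f c1 c2 (s s' : state R) :
  exec v P f c1 s = Leaf (Some s') ->
  exec v P f.+1 (Seq c1 c2) s = exec v P f c2 s'.
Proof. by move=> /= ->. Qed.

Lemma exec_If (P : program) f r c1 c2 (s : state R) :
  exec v P f.+1 (If r c1 c2) s =
  exec v P f (if as_real (regs s r) == 0 then c2 else c1) (tick s).
Proof. by []. Qed.

Lemma exec_Seq_Rand (P : program) f r a c (s : state R) :
  (0 < as_nat (regs s a))%N ->
  exec v P f.+2 (Seq (Do (Rand r a)) c) s =
  Draw (as_nat (regs s a)) (fun i =>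
    exec v P f.+1 c (set_reg (tick s) r (Int i))).
Proof. by rewrite lt0n /= => /negPf ->. Qed.

Lemma exec_Par (P : program) f c1 c2 (s : state R) :
  exec v P f.+1 (Par c1 c2) s =
  rbind (exec v P f c1 (fork s)) (fun o1 => rbind (exec v P f c2 (fork s))
    (fun o2 => match o1, o2 with
      | Some s1, Some s2 =>
          Leaf (if race s1 s2 then None else Some (join (tick s) s1 s2))
      | _, _ => Leaf None
      end)).
Proof. by []. Qed.

Lemma exec_assign_left f (s : state R) : exec v assign f.+4 assign_left s =
  exec v assign f.+2 assign_range
    (tick (set_reg (tick s) 1 (arith Half (regs s 1) (regs s 1)))).
Proof. by []. Qed.

Lemma exec_assign_right f (s : state R) : exec v assign f.+4 assign_right s =
  exec v assign f.+1 assign_range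
    (tick (set_reg
      (tick (set_reg (tick s) 1 (arith Defs.Sub (regs s 1) (regs s 4))))
      2 (arith Add (regs s 2) (regs s 4)))).
Proof.
by [].
Qed.

Lemma exec_assign_first_then f c i lo p (s : state R) :
  regs s 0%N = Int n -> regs s 1%N = Int p.+1 -> regs s 2%N = Int lo ->
  regs s 3%N = Int i ->
  exists s', [/\ exec v assign (f.+4.+2) (assign_first_then c) s =
                   exec v assign f.+1 c s',
    [/\ regs s' 0%N = Int n, regs s' 1%N = Int p, regs s' 2%N = Int lo.+1 &
        regs s' 4%N = Int p./2],
    Defs.mem s' = upd (Defs.mem s) lo (Int i),
    rd s' = rd s /\ wr s' = lo :: wr s &
    wk s' = (wk s + 5)%N /\ dp s' = (dp s + 5)%N].
Proof.
move=> r0 r1 r2 r3; eexists; split.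
- rewrite /assign_first_then; do 5 (erewrite exec_Seq; [|reflexivity]).
  reflexivity.
- by rewrite /= /upd /= r0 r1 r2 /= subn1 addn1.
- by rewrite /= r2 r3.
- by rewrite /= r2.
- by rewrite /= !addnS !addn0.
Qed.

Lemma nth_interval_split (w1 w2 : seq nat) (i lo a : nat) :
  (lo <= a)%N -> nth 0%N (i :: w1 ++ w2) (a - lo) =
  if a == lo then i else
  if (a < lo.+1 + size w1)%N then nth 0%N w1 (a - lo.+1)
  else nth 0%N w2 (a - (lo.+1 + size w1)).
Proof.
move=> le_lo; case: eqP => [->|ne]; first by rewrite subnn.
have -> : (a - lo = (a - lo.+1).+1)%N by lia.
rewrite /= nth_cat.
have -> : (a - lo.+1 < size w1)%N = (a < lo.+1 + size w1)%N by lia.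
by case: ifP => // _; rewrite subnDA.
Qed.

(* [s0] is the state at the fork, reached after a test, a draw and 5 further
   instructions; [s1] and [s2] are the states at which the recursive calls of
   the two branches start, 2 and 3 steps after the fork. *)
Lemma assigned_join lo a b d1 d2 i (s s0 s1 s2 : state R) o1 o2 w1 w2 :
  (i < n)%N ->
  Defs.mem s0 = upd (Defs.mem s) lo (Int i) -> rd s0 = rd s ->
  wr s0 = lo :: wr s ->
  wk s0 = (wk s + 7)%N -> dp s0 = (dp s + 7)%N ->
  Defs.mem s1 = Defs.mem s0 -> rd s1 = [::] -> wr s1 = [::] ->
  wk s1 = 2 -> dp s1 = 2 ->
  Defs.mem s2 = Defs.mem s0 -> rd s2 = [::] -> wr s2 = [::] ->
  wk s2 = 3 -> dp s2 = 3 ->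
  assigned lo.+1 a d1 s1 o1 w1 -> assigned (lo.+1 + a) b d2 s2 o2 w2 ->
  assigned lo (a + b).+1 (8 + maxn (2 + d1) (3 + d2)) s
    (match o1, o2 with
     | Some t1, Some t2 =>
         if race t1 t2 then None else Some (join (tick s0) t1 t2)
     | _, _ => None
     end) (i :: w1 ++ w2).
Proof.
move=> i_lt m0 rd0 wr0 wk0 dp0 m1 rd1 wr1 wk1 dp1 m2 rd2 wr2 wk2 dp2.
case=> t1 [-> [sz1 lt1] mt1 [rt1 wt1] [kt1 et1]].
case=> t2 [-> [sz2 lt2] mt2 [rt2 wt2] [kt2 et2]].
(* Neither branch reads memory, and they write to disjoint intervals. *)
have -> : race t1 t2 = false.
  rewrite /race rt1 rt2 rd1 rd2 !has_nil !orbF /=.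
  apply/hasPn => x; rewrite wt2 wr2 /= => x2.
  by change (x \notin wr t1); rewrite wt1 wr1 /=; lia.
exists (join (tick s0) t1 t2); split=> //=.
- by rewrite size_cat sz1 sz2 i_lt all_cat lt1 lt2.
- move=> x; rewrite wt1 wr1 mt1 mt2 m1 m2 m0 in_nil /upd /=.
  have [le_lo|lt_lo] := leqP lo x; last first.
    by rewrite !ifF //; lia.
  rewrite nth_interval_split // sz1.
  case: eqP => [->|ne]; first rewrite ltnn /=.
    by rewrite (leqNgt _ lo) leq_addr /= ifT //; lia.
  have lt_lo : (lo < x)%N by lia.
  rewrite lt_lo /=; case: (ltnP x (lo.+1 + a)) => [lt_a|le_a] /=.
    by rewrite ifT //; lia.
  by case: ifP => hb; [rewrite ifT //; lia|rewrite ifF //; lia].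
- split; first by rewrite rd0 rt1 rt2 rd1 rd2 /= cats0.
  by move=> x; rewrite wr0 /= inE !mem_cat wt1 wt2 wr1 wr2 /=; lia.
- by rewrite kt1 kt2 wk1 wk2 wk0 dp0; lia.
Qed.

(** Induction on [L]: both halves of the goods after the first have length below [2 ^ L]. A level
    adds 8 to the depth up to the fork and 3 for the slower entry. The free [f] absorbs the unequal
    fuel left to the two branches. *)
Lemma exec_assign_range (L f lo len : nat) (s : state R) :
  (0 < n)%N -> (len < 2 ^ L)%N ->
  regs s 0%N = Int n -> regs s 1%N = Int len -> regs s 2%N = Int lo ->
  coupled (assigned lo len (11 * L + 1) s)
    (exec v assign (f + 12 * L).+2 assign_range s) (draws n len).
Proof.
move=> n_gt0; elim: L f lo len s => [|L IH] f lo len s len_lt r0 r1 r2.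
  have len0 : len = 0%N by lia.
  rewrite len0 in r1 *; rewrite /= r1 /= eqxx /=.
  exists (tick s); split=> //=.
  - by move=> a; case: ifP => //; lia.
  - by split=> // a; rewrite (_ : (_ <= _ < _)%N = false) ?orbF //; lia.
  - lia.
case: len len_lt r1 => [|p] len_lt r1.
  rewrite /= r1 /= eqxx /=.
  exists (tick s); split=> //=.
  - by move=> a; case: ifP => //; lia.
  - by split=> // a; rewrite (_ : (_ <= _ < _)%N = false) ?orbF //; lia.
  - lia.
have -> : (f + 12 * L.+1).+2 = ((f + 12 * L).+4.+4.+4.+2)%N by lia.
rewrite exec_If r1 [as_real _]/= pnatr_eq0 [(_ == _)%N]/=.
rewrite exec_Seq_Rand [regs _]/= r0 // [as_nat _]/=; split=> // i i_lt.
set s1 := set_reg _ _ _.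
have [||||s0 [-> [q0 q1 q2 q4] mem0 [rd0 wr0] [wk0 dp0]]] :=
  exec_assign_first_then (f + 12 * L).+4.+2
    (Par assign_left assign_right) i lo p s1 => //.
rewrite exec_Par exec_assign_left exec_assign_right.
rewrite [draws n p](_ : _ = draws n (p./2 + (p - p./2))%N); last first.
  by congr draws; lia.
rewrite drawsD rbindA.
set t1 := tick (set_reg _ 1 _); set t2 := tick (set_reg _ 2 _).
have len_lt2 : (p.+1 < 2 * 2 ^ L)%N by rewrite -expnS.
have h1 : coupled (assigned lo.+1 p./2 (11 * L + 1) t1)
    (exec v assign (f + 12 * L).+4 assign_range t1) (draws n p./2).
  by apply: (IH f.+2); rewrite ?/t1 /= /upd /= ?q0 ?q1 ?q2 //; lia.
have h2 : coupled (assigned (lo.+1 + p./2) (p - p./2) (11 * L + 1) t2)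
    (exec v assign (f + 12 * L).+3 assign_range t2) (draws n (p - p./2)).
  by apply: (IH f.+1); rewrite ?/t2 /= /upd /= ?q0 ?q1 ?q2 ?q4 //; lia.
apply: coupled_bind h1 _ => o1 w1 as1; rewrite rbindA.
apply: coupled_bind h2 _ => o2 w2 as2.
have : assigned lo p.+1 (11 * L.+1 + 1) s
    (match o1, o2 with
     | Some u1, Some u2 =>
         if race u1 u2 then None else Some (join (tick s0) u1 u2)
     | _, _ => None
     end) (i :: w1 ++ w2).
  have := assigned_join lo p./2 (p - p./2) (11 * L + 1) (11 * L + 1)
    i s s0 t1 t2 o1 o2 w1 w2 i_lt mem0 rd0 wr0.
  rewrite wk0 dp0 (_ : p./2 + (p - p./2) = p)%N; last lia.
  rewrite (_ : 8 + maxn (2 + (11 * L + 1)) (3 + (11 * L + 1)) =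
               11 * L.+1 + 1)%N; last lia.
  by apply=> //=; lia.
by case: (o1) => [u1|]; case: (o2).
Qed.
End Execution.

Lemma run_assign (R : realType) (n m : nat) (v : valuations R n m) :
  (0 < n)%N -> exists fuel,
  coupled (assigned (n := n) 0 m (11 * (trunc_log 2 m).+1 + 1) (init R n m))
    (run v assign fuel) (draws n m).
Proof.
move=> n_gt0; eexists; apply: (exec_assign_range v _ 0) => //.
exact: trunc_log_ltn.
Qed.

Lemma assigned_owner_map (R : realType) (n m d : nat) (i0 : 'I_n)
    (Q : allocation n m -> Prop) (o : option (state R)) (w : seq nat) :
  assigned (n := n) 0 m d (init R n m) o w -> Q (owner_map i0 w) -> outputs Q o.
Proof.
case=> s [-> [sz_w w_lt] mem_s _ _] Qw; exists (owner_map i0 w); split=> // g.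
by rewrite mem_s /= add0n ltn_ord subn0 nat_owner_map.
Qed.

(** * Choice of parameters and success probability *)

(** With [N = n + m], 3 pays for the [n ^ 2 * m <= N ^ 3] triples, 2 for [exp 1 <= N ^ 2], and the
    absolute value of [c] for the failure probability. *)
Definition tail_exponent (R : realType) (c : R) : R := 5 + `|c|.

Definition sqrt_ratio (R : realType) (n m : nat) : R :=
  Num.max 1 (Num.sqrt (m%:R / n%:R)).

Definition removal_bound (R : realType) (c : R) (n m : nat) : nat :=
  Num.truncn (2 * tail_exponent R c * ln ((n + m)%:R : R) * sqrt_ratio R n m).

Lemma ln_nat_ge0 (R : realType) (a : nat) : 0 <= ln (a%:R : R).
Proof. by case: a => [|a]; [rewrite ln0|rewrite ln_ge0 // ler1n]. Qed.

Lemma ler_ln_nat (R : realType) (a b : nat) :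
  (a <= b)%N -> ln (a%:R : R) <= ln (b%:R : R).
Proof.
case: a => [|a] le_ab; first by rewrite ln0 // ln_nat_ge0.
by rewrite ler_ln ?posrE ?ltr0n ?ler_nat // (leq_trans _ le_ab).
Qed.

Lemma union_bound_le (R : realType) (c : R) (n m : nat) :
  (0 < n)%N -> (0 < m)%N ->
  n%:R ^+ 2 * m%:R * expR (1 - tail_exponent R c * ln ((n + m)%:R : R))
  <= (n%:R `^ c)^-1.
Proof.
move=> n_gt0 m_gt0; set N : R := (n + m)%:R.
have n_gt0' : 0 < n%:R :> R by rewrite ltr0n.
have N_ge2 : 2 <= N by rewrite /N ler_nat; lia.
have N_gt0 : 0 < N by lra.
have [nN mN] : n%:R <= N /\ m%:R <= N by rewrite /N !ler_nat; lia.
(* The quadratic bound at [1/2] gives [exp (1/2) <= 2 <= N]. *)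
have e_le : expR 1 <= N ^+ 2 :> R.
  have -> : expR 1 = expR (2^-1) ^+ 2 :> R.
    by rewrite -expRM_natl mulfV // pnatr_eq0.
  have := expR_le_quadratic R 2^-1 (lexx _); have := expR_gt0 (2^-1 : R).
  set x := expR _ => x_gt0 x_le; rewrite ler_pXn2r ?nnegrE //; try exact: ltW.
  by apply: le_trans N_ge2; apply: le_trans x_le _; lra.
have n2m : n%:R ^+ 2 * m%:R <= N ^+ 3.
  by rewrite [leRHS]exprSr ler_pM ?exprn_ge0 // ler_pXn2r ?nnegrE // ltW.
apply: (@le_trans _ _
  (N ^+ 3 * (N ^+ 2 * expR (- (tail_exponent R c * ln N))))).
  rewrite expRD ler_pM ?mulr_ge0 ?exprn_ge0 ?expR_ge0 //.
  by rewrite ler_wpM2r ?expR_ge0.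
rewrite mulrA -exprD -[N in N ^+ _]lnK ?posrE // -expRM_natl -expRD.
rewrite -powRN /powR gt_eqF // ler_expR /tail_exponent mulrDl mulNr.
have : c * ln n%:R <= `|c| * ln N.
  apply: le_trans (ler_wpM2r (ln_nat_ge0 _ _) (ler_norm c)) _.
  by rewrite ler_wpM2l // ler_ln_nat // leq_addr.
by rewrite (_ : (3 + 2)%N%:R = 5 :> R) //; lra.
Qed.

Lemma assign_EF_whp (R : realType) (c : R) :
  correct_whp assign c (fun n m v A => EF (removal_bound R c n m) v A).
Proof.
move=> n m v n_gt0 v_ge0; pose i0 := Ordinal n_gt0.
have [fuel run_v] := run_assign R n m v n_gt0; exists fuel.
(* Without goods every allocation is envy-free; the moment bound needs [0 < m]. *)
have [m0|m_gt0] := posnP m.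
  apply: le_trans (coupled_prob _ _ _ _ (fun=> 1) _ _ run_v _).
    by rewrite expect_const_draws // gerBl invr_ge0 powR_ge0.
  move=> o w ow; rewrite asboolT //.
  apply: (assigned_owner_map _ _ _ _ i0 _ _ _ ow).
  move=> i j; exists set0; split; rewrite ?sub0set ?cards0 //.
  rewrite /bundle_value !big1 // => g; have := ltn_ord g;
    by rewrite [X in (_ < X)%N]m0.
set k := removal_bound R c n m; set r := sqrt_ratio R n m.
have r_ge1 : 1 <= r by rewrite /r /sqrt_ratio le_max lexx.
have [nR mR] : 0 < n%:R :> R /\ 0 < m%:R :> R by rewrite !ltr0n.
have r2 : m%:R <= n%:R * r ^+ 2.
  rewrite mulrC -ler_pdivrMr // -[leLHS]sqr_sqrtr ?divr_ge0 //.
  rewrite ler_pXn2r ?nnegrE ?sqrtr_ge0 //; last lra.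
  by rewrite /r /sqrt_ratio le_max lexx orbT.
(* For this value [4 * lam ^+ 2 * m <= n] reduces to [r2], and [1 <= r] gives [lam <= 1/2]. *)
pose lam := (2 * r)^-1.
have lamr : lam * (2 * r) = 1 by rewrite mulVf // gt_eqF //; lra.
have lam_gt0 : 0 < lam by rewrite invr_gt0; lra.
have lam_itv : 0 <= lam <= 2^-1 by apply/andP; split; nra.
have lam_m : 4 * lam ^+ 2 * m%:R <= n%:R.
  apply: (@le_trans _ _ (4 * lam ^+ 2 * (n%:R * r ^+ 2))).
    by rewrite ler_wpM2l // mulr_ge0 ?sqr_ge0.
  rewrite (_ : _ * _ = n%:R * (lam * (2 * r)) ^+ 2); last by ring.
  by rewrite lamr expr1n mulr1.
(* The factor 2 in [removal_bound] cancels that of [lam], and [k.+1] makes up for the truncation. *)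
have lam_k : tail_exponent R c * ln ((n + m)%:R : R) <= lam * k.+1%:R.
  have := ltW (truncnS_gt (2 * tail_exponent R c * ln ((n + m)%:R : R) * r)).
  rewrite -/k -(ler_pM2l lam_gt0); apply: le_trans.
  rewrite [leRHS](_ : _ = lam * (2 * r) *
    (tail_exponent R c * ln ((n + m)%:R : R))); last by ring.
  by rewrite lamr mul1r.
apply: le_trans (coupled_prob _ _ _ _ _ _ _ run_v _); last first.
  move=> o w ow; have [s [_ [sz_w w_lt] _ _ _]] := ow.
  apply: le_trans (EF_indicator_ge lam k i0 v w _ v_ge0 sz_w w_lt) _.
    exact: ltW.
  rewrite ler_nat; case: asboolP => // EFk; rewrite asboolT //.
  exact: (assigned_owner_map _ _ _ _ i0 _ _ _ ow EFk).
apply: le_trans (EF_expectation_ge lam k v m_gt0 n_gt0 lam_itv lam_m).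
rewrite lerD2l lerN2; apply: le_trans (union_bound_le R c n m n_gt0 m_gt0).
by rewrite ler_wpM2l ?mulr_ge0 ?sqr_ge0 // ler_expR lerD2l lerN2.
Qed.

(** * Asymptotic bounds *)

Lemma removal_bound_Otilde (R : realType) (c : R) :
  Otilde (removal_bound R c) (fun n m => sqrt_ratio R n m).
Proof.
exists 1%N, (2 * tail_exponent R c) => n m _ _ _; rewrite expr1 mulrA.
have h : 0 <= 2 * tail_exponent R c * ln ((n + m)%:R : R) * sqrt_ratio R n m.
  rewrite !mulr_ge0 ?ln_nat_ge0 // ?addr_ge0 //.
  by rewrite /sqrt_ratio le_max ler01.
by have /andP[] := truncn_itv h.
Qed.

Lemma trunc_log2_le_ln (R : realType) (a : nat) :
  (0 < a)%N -> (trunc_log 2 a)%:R * ln (2 : R) <= ln (a%:R : R).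
Proof.
move=> a_gt0; rewrite mulr_natl -lnXn // -natrX ler_ln_nat //.
exact: trunc_logP.
Qed.

(** The scale [x] is a parameter to serve both depth bounds: [ln (n + m)] with [y = 1], and [ln n]
    with [y = d]. The constant term 12 is absorbed through [ln 2 <= x]. *)
Lemma assign_depth_le (R : realType) (m : nat) (x y : R) :
  (0 < m)%N -> 0 <= y -> ln (m%:R : R) <= y * x -> ln 2 <= x ->
  (11 * (trunc_log 2 m).+1 + 1)%N%:R <= (11 * y + 12) / ln 2 * x.
Proof.
move=> m_gt0 y_ge0 mx x_ge.
have ln2 : 0 < ln (2 : R) by rewrite ln_gt0 // ltr1n.
have := trunc_log2_le_ln R m m_gt0; set t := trunc_log 2 m => tm.
rewrite mulrAC ler_pdivlMr // (_ : (_ + _)%N%:R = 11 * t%:R + 12); last first.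
  by rewrite natrD natrM -natr1; ring.
nra.
Qed.

Theorem theorem7 (R : realType) :
  exists (P : program) (work depth : nat -> nat -> nat)
         (k : R -> nat -> nat -> nat),
    [/\ has_cost R P work depth,
        bigO work (fun _ m => m%:R : R),
        bigO depth (fun n m => ln ((n + m)%:R : R)) /\
        (forall d : nat,
           bigO_on (fun n m => (1 < n)%N /\ (m <= n ^ d)%N) depth
                   (fun n _ => ln (n%:R : R))),
        (forall c : R,
           Otilde (k c) (fun n m => Num.max 1 (Num.sqrt (m%:R / n%:R) : R))) &
        RNC P (fun c n m v A => EF (k c n m) v A)].
Proof.
pose work (n m : nat) := (14 * m + 1)%N.
pose depth (n m : nat) := (11 * (trunc_log 2 m).+1 + 1)%N.
have cost : has_cost R assign work depth.
  move=> n m v n_gt0 _; have [fuel run_v] := run_assign R n m v n_gt0.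
  exists fuel; apply: (coupled_surely _ _ _ _ _ _ run_v).
  by move=> _ w [s [-> _ _ _ [/= -> le_d]]].
have depthO : bigO depth (fun n m => ln ((n + m)%:R : R)).
  exists ((11 * 1 + 12) / ln 2) => n m n_gt0 m_gt0 _.
  by apply: assign_depth_le; rewrite ?mul1r ?ler_ln_nat ?leq_addl //; lia.
exists assign, work, depth, (removal_bound R); split=> //.
(* As [m >= 1], [14 * m + 1 <= 15 * m]. *)
- exists 15 => n m _ m_gt0 _; rewrite -natrM ler_nat /work; lia.
(* Here [m <= n ^ d] gives [ln m <= d * ln n], and [1 < n] gives [ln 2 <= ln n]. *)
- split=> // d; exists ((11 * d%:R + 12) / ln 2) => n m n_gt0 m_gt0.
  case=> n_gt1 m_le.
  apply: assign_depth_le => //; last exact: ler_ln_nat.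
  by rewrite mulr_natl -lnXn ?ltr0n // -natrX ler_ln_nat.
- exact: removal_bound_Otilde.
- split; last exact: assign_EF_whp.
  exists work, depth; split=> //.
  + exists 1%N, 15 => n m _ m_gt0 _; rewrite expr1 -natrM ler_nat /work; lia.
  + case: depthO => C hC; exists 1%N, C => n m n_gt0 m_gt0 _.
    by rewrite expr1 mulr1 hC.
Qed.
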